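(* If $\lambda$ is a singular limit of strongly compact cardinals, then $\chi(\lambda^+)=\mathrm{cf}(\lambda)$.
   Context: For a regular uncountable cardinal $\kappa$, a $C$-sequence over $\kappa$ is $\langle C_\beta\mid\beta<\kappa\rangle$ with each $C_\beta$ a closed subset of $\beta$ with $\sup(C_\beta)=\sup(\beta)$. $\chi(\kappa)$ is $0$ if $\kappa$ is weakly compact; otherwise it is the least cardinal $\chi\le\kappa$ such that for every $C$-sequence $\langle C_\beta\mid\beta<\kappa\rangle$ there exist $\Delta\in[\kappa]^\kappa$ and $b:\kappa\to[\kappa]^\chi$ with $\Delta\cap\alpha\subseteq\bigcup_{\beta\in b(\alpha)}C_\beta$ for all $\alpha<\kappa$. *)

(* Defs.v *)
From HB Require Import structures.
From mathcomp Require Import all_boot all_order.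
From mathcomp Require Import boolp classical_sets functions cardinality.
From mathcomp Require Import filter wochoice.

Set Implicit Arguments.
Unset Strict Implicit.
Unset Printing Implicit Defensive.

Local Open Scope classical_set_scope.
Local Open Scope card_scope.

(* An ordinal is a well-ordered type, and the ordinals below it are its
   elements: a : K stands for the ordinal below a.  An initial segment
   A : set K (setT included) is likewise an ordinal; it is a cardinal when it is
   an initial ordinal.  A cardinal that is the value of an invariant is
   represented by a set of that cardinality, so equality of cardinals is #=. *)

Definition card_lt (T U : Type) (A : set T) (B : set U) : Prop :=
  A #<= B /\ ~ (B #<= A).

Section Cardinals.
Context {d : Order.disp_t} {K : orderType d}.

Definition below (a : K) : set K := [set x | (x < a)%O].

Definition is_cardinal (A : set K) : Prop :=
  forall a, A a -> card_lt (below a) A.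

Definition cofinal_set (A : set K) : Prop :=
  forall x, exists2 a, A a & (x <= a)%O.

End Cardinals.

Section Invariants.
Context {d : Order.disp_t} (K : orderType d).

Definition cof : set K :=
  xget set0 [set A : set K | cofinal_set A /\
    forall B : set K, cofinal_set B -> A #<= B].

Definition singular_cardinal : Prop :=
  [/\ is_cardinal [set: K], infinite_set [set: K] & card_lt cof [set: K]].

(* K is uncountable and satisfies the partition relation K -> (K)^2_2; a
   colouring f of the pairs {x, y} is read at x < y only. *)
Definition weakly_compact : Prop :=
  [/\ is_cardinal [set: K], ~ countable [set: K] &
    forall f : K -> K -> bool, exists H : set K, H #= [set: K] /\
      exists c : bool, forall x y, H x -> H y -> (x < y)%O -> f x y = c].

(* D is a subset of the ordinal b, closed in b: it contains every nonzero g < b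
   with sup (D `&` g) = g.  The set of suprema of a set is computed in K, so
   that the supremum of the empty set is the least element of K. *)
Definition closed_below (b : K) (D : set K) : Prop :=
  D `<=` below b /\
  forall g : K, (g < b)%O -> D `&` below g !=set0 ->
    supremums (D `&` below g) g -> D g.

Definition C_sequence (C : K -> set K) : Prop :=
  forall b : K, closed_below b (C b) /\
    supremums (C b) = supremums (below b).

Definition chi_property (X : set K) : Prop :=
  forall C : K -> set K, C_sequence C ->
    exists (Delta : set K) (B : K -> set K),
      [/\ Delta #= [set: K],
          forall a : K, B a #= X &
          forall a : K,
            Delta `&` below a `<=` \bigcup_(b in B a) C b].

(* The cardinals X <= K are those of the subsets of K. *)
Definition chi : set K :=
  if pselect weakly_compact then set0
  else xget set0 [set X : set K | chi_property X /\
    forall Y : set K, chi_property Y -> X #<= Y].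

End Invariants.

Arguments cof {d} K.
Arguments chi {d} K.

Section StronglyCompact.

(* M matters only through its cardinality. *)
Definition card_complete (T S : Type) (M : set T) (F : set_system S) : Prop :=
  forall G : set_system S, card_lt G M -> G `<=` F -> F (\bigcap_(A in G) A).

Definition strongly_compact (T : Type) (M : set T) : Prop :=
  ~ countable M /\
  forall (S : Type) (F : set_system S), ProperFilter F -> card_complete M F ->
    exists U : set_system S,
      [/\ UltraFilter U, card_complete M U & F `<=` U].

End StronglyCompact.

Definition limit_of_strongly_compacts d (L : orderType d) : Prop :=
  forall a : L, exists m : L,
    [/\ (a < m)%O, is_cardinal (below m) & strongly_compact (below m)].

(* K is the least cardinal greater than L. *)
Definition is_successor_cardinal d (L : orderType d) d' (K : orderType d') :
    Prop :=
  [/\ is_cardinal [set: K],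
      card_lt [set: L] [set: K] &
      forall m : K, is_cardinal (below m) -> below m #<= [set: L]].

(* Main.v *)
(* Write K for lambda^+ and L for lambda.  As K embeds into the powerset of L,
   the Sierpinski colouring shows that K is not weakly compact.

   Lower bound: every b < K has a cofinal subset of size < lambda because lambda
   is singular, hence a club C_b of size < lambda.  Fewer than cf(lambda) of
   these cannot cover a set of size lambda.

   Upper bound: for each l < lambda fix a strongly compact m_l > l and an
   m_l-complete, weakly normal filter V_l on K containing the co-bounded sets.
   Weak normality makes the set Delta of those c that lie in C_b for V_l-almost
   all b, for every l, unbounded: iterate omega times the choice of a bound,
   common to all l, for the next element of C_b.  Below a given a, injecting a
   into lambda splits Delta into cf(lambda) pieces of sizes < m_l, and by
   completeness of V_l each piece is contained in a single C_b. *)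

Require Import Defs.
From mathcomp Require Import all_boot all_order.
From mathcomp Require Import boolp classical_sets functions cardinality.
From mathcomp Require Import filter wochoice.

Set Implicit Arguments.
Unset Strict Implicit.
Unset Printing Implicit Defensive.

Import Order.TTheory.

Local Open Scope classical_set_scope.
Local Open Scope card_scope.

(** * Comparing cardinalities of sets *)

Lemma set0_or_nonempty (T : Type) (A : set T) : A = set0 \/ A !=set0.
Proof. by case: (pselect (A !=set0)) => [|/nonemptyPn]; [right|left]. Qed.

Lemma card_le_inj (T U : Type) (A : set T) (B : set U) (f : T -> U) :
  (forall x, A x -> B (f x)) ->
  (forall x y, A x -> A y -> f x = f y -> x = y) -> A #<= B.
Proof.
move=> fAB fI; apply: (@card_le_trans _ _ _ (f @` A)).
  have : f @` A #= A.
    by apply: inj_card_eq => x y /set_mem Ax /set_mem Ay; exact: fI.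
  by rewrite card_eq_le => /andP[].
by apply: subset_card_le => _ [x Ax <-]; exact: fAB.
Qed.

Lemma card_le_surj (T U : Type) (A : set T) (B : set U) (f : U -> T) :
  A `<=` f @` B -> A #<= B.
Proof. by move=> /subset_card_le/card_le_trans; apply; exact: card_image_le. Qed.

(** The point [u] excludes an empty [U], into which [T] may have no function at all. *)
Lemma card_le_fun (T U : Type) (u : U) (A : set T) (B : set U) : A #<= B ->
  exists f : T -> U, (forall x, A x -> B (f x)) /\
    (forall x y, A x -> A y -> f x = f y -> x = y).
Proof.
elim/Ppointed: U => U in u B *; first by have := no u.
move=> /pcard_leP/injfunPex[f fAB fI]; exists f; split=> // x y Ax Ay.
by apply: fI; exact/mem_set.
Qed.

Lemma card_leX (T T' U U' : Type) (A : set T) (A' : set T') (B : set U)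
    (B' : set U') : A #<= A' -> B #<= B' -> A `*` B #<= A' `*` B'.
Proof.
move=> AA' BB'; have [-> //|[[a b] /= [Aa Bb]]] := set0_or_nonempty (A `*` B).
have [t _] : A' !=set0.
  have [A'0|//] := set0_or_nonempty A'.
  by move: AA'; rewrite A'0 => /card_le0P A0; move: Aa; rewrite A0.
have [u _] : B' !=set0.
  have [B'0|//] := set0_or_nonempty B'.
  by move: BB'; rewrite B'0 => /card_le0P B0; move: Bb; rewrite B0.
have [f [fA fI]] := card_le_fun t AA'; have [g [gB gI]] := card_le_fun u BB'.
apply: (@card_le_inj _ _ _ _ (fun p => (f p.1, g p.2))).
  by move=> [x y] /= [Ax By]; split; [exact: fA|exact: gB].
by move=> [x y] [x' y'] /= [? ?] [? ?] [/fI -> // /gI ->].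
Qed.

Lemma card_le_bigcup (I T U : Type) (J : set I) (F : I -> set T) (M : set U) :
  (forall i, J i -> F i #<= M) -> \bigcup_(i in J) F i #<= J `*` M.
Proof.
move=> FM; have [-> //|[t0 [i0 Ji0 Fit0]]] := set0_or_nonempty (\bigcup_(i in J) F i).
have [u _] : M !=set0.
  have [M0|//] := set0_or_nonempty M.
  by move: (FM _ Ji0); rewrite M0 => /card_le0P F0; move: Fit0; rewrite F0.
have /choice[f fP] (i : I) : exists f : T -> U, J i ->
    (forall x, F i x -> M (f x)) /\
    (forall x y, F i x -> F i y -> f x = f y -> x = y).
  have [Ji|nJ] := pselect (J i); last by exists (fun=> u).
  by have [f fP] := card_le_fun u (FM _ Ji); exists f.
have /choice[k kP] (t : T) : exists i, (\bigcup_(i in J) F i) t -> J i /\ F i t.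
  have [[i Ji Fi]|nt] := pselect ((\bigcup_(i in J) F i) t); first by exists i.
  by exists i0.
apply: (@card_le_inj _ _ _ _ (fun t => (k t, f (k t) t))) => [t /kP[Jk Fk]|].
  by split=> //=; have [+ _] := fP _ Jk; apply.
move=> x y /kP[Jx Fx] /kP[Jy Fy] [kE].
rewrite -kE => fE; move: Fy; rewrite -kE => Fy.
by have [_ +] := fP _ Jx; apply.
Qed.

(** Hilbert's hotel: a sequence starting at [x] and continuing inside [A] is shifted by one place;
    all other points stay fixed. *)
Lemma card_le_setD1 (T : Type) (A : set T) (x : T) :
  infinite_set A -> A #<= A `\ x.
Proof.
move=> Ainf.
have [Ax|nAx] := pselect (A x); last first.
  by apply: subset_card_le => y Ay; split=> //= yx; apply: nAx; rewrite -yx.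
have /infiniteP/(card_le_fun x)[g [gA gI]] : infinite_set (A `\ x).
  by apply: infinite_setD => //; exact: finite_set1.
pose g' n := if n is m.+1 then g m else x.
have g'I m n : g' m = g' n -> m = n.
  case: m n => [|m] [|n] //=.
  - by move=> xE; have [_ /=] := gA n I; case.
  - by move=> xE; have [_ /=] := gA m I; case.
  - by move=> /gI ->.
have /choice[h hP] (y : T) : exists z,
    (exists2 n, y = g' n & z = g n) \/ ((~ exists n, y = g' n) /\ z = y).
  have [[n yE]|ny] := pselect (exists n, y = g' n).
    by exists (g n); left; exists n.
  by exists y; right.
apply: (@card_le_inj _ _ _ _ h) => [y Ay|y z Ay Az].
  have [[n _ ->]|[ny ->]] := hP y; first exact: gA.
  by split=> //= yx; apply: ny; exists 0.
have [[m yE ->]|[ny ->]] := hP y; have [[n zE ->]|[nz ->]] := hP z => //.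
- by move=> /gI mn; rewrite yE zE mn.
- by move=> gE; case: nz; exists m.+1.
- by move=> gE; case: ny; exists n.+1.
Qed.

Lemma cantor (T : Type) : ~ ([set: set T] #<= [set: T]).
Proof.
move=> TT; have [t _] : [set: T] !=set0.
  have [T0|//] := set0_or_nonempty [set: T].
  move: TT; rewrite T0 => /card_le0P TT0.
  by have : [set: set T] set0 by []; rewrite TT0.
have [f [_ fI]] := card_le_fun t TT.
pose D := [set x | exists2 A, f A = x & ~ A x].
have nDf : ~ D (f D).
  by move=> /[dup] DfD [A /(fI _ _ I I) ->].
by apply: (nDf); exists D.
Qed.

(** * Complete filters *)

Lemma complete_bigcap (T S I : Type) (M : set T) (F : set_system S)
    (J : set I) (P : I -> set S) : card_complete M F -> card_lt J M ->
  (forall i, J i -> F (P i)) -> F (\bigcap_(i in J) P i).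
Proof.
move=> Fcomp [JM MJ] FP.
have -> : \bigcap_(i in J) P i = \bigcap_(A in P @` J) A.
  by rewrite bigcap_image.
apply: Fcomp => [|_ [i Ji <-]]; last exact: FP.
split; first exact: card_le_trans (card_image_le _ _) JM.
by move=> MPJ; apply: MJ; exact: card_le_trans MPJ (card_image_le _ _).
Qed.

Lemma countably_complete (T S : Type) (M : set T) (F : set_system S)
    (P : nat -> set S) : ~ countable M -> card_complete M F ->
  (forall n, F (P n)) -> F (\bigcap_n P n).
Proof.
move=> Mctbl Fcomp FP; apply: complete_bigcap Fcomp _ _ => //.
split=> //; apply/infiniteP => Mfin; apply: Mctbl.
exact: finite_set_countable.
Qed.

(** * Well-founded recursion *)

Lemma wf_of_minimal (W : Type) (R : W -> W -> Prop) :
  (forall P : set W, P !=set0 -> exists2 m, P m & forall x, R x m -> ~ P x) ->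
  well_founded R.
Proof.
move=> Rmin a; apply: contrapT => na.
have [|m /= nm mmin] := Rmin [set x | ~ Acc R x]; first by exists a.
by apply: nm; constructor => x /mmin /contrapT.
Qed.

(* Send each element of S to an element of X not yet taken, for as long as
   one is left. *)
Lemma card_le_or_initial (W T : Type) (R : W -> W -> Prop) (S : set W)
    (X : set T) : well_founded R ->
  (forall x y, S x -> S y -> x <> y -> R x y \/ R y x) ->
  S #<= X \/ exists2 p, S p & X #<= [set w | R w p].
Proof.
elim/Pchoice: T => T in X *.
move=> Rwf Rtot.
have [S0|[s Ss]] := set0_or_nonempty S; first by left; rewrite S0.
have [X0|[x0 Xx0]] := set0_or_nonempty X; first by right; exists s => //; rewrite X0.
(* [x0] is a junk value, taken only when [X] has no fresh element left. *)
pose step w (f : forall v, R v w -> T) :=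
  xget x0 (X `\` [set t | exists v (h : R v w), f v h = t]).
pose f := Fix Rwf (fun=> T) step.
have fE w : f w = xget x0 (X `\` (f @` [set v | R v w])).
  rewrite /f Fix_eq => [|v g h gh]; last first.
    rewrite /step; congr (xget _ (_ `\` _)).
    by apply/seteqP; split=> t [u [Ru <-]]; exists u, Ru; rewrite gh.
  rewrite {1}/step; congr (xget _ (_ `\` _)).
  by apply/seteqP; split=> t => [[u [Ru <-]]|[u Ru <-]]; [exists u|exists u, Ru].
have [[p Sp Xp]|np] := pselect (exists2 p, S p & X `<=` f @` [set v | R v p]).
  by right; exists p => //; exact: card_le_surj Xp.
have fP w : S w -> X (f w) /\ forall v, R v w -> f v <> f w.
  move=> Sw; rewrite fE; case: xgetP => [t _ [Xt nt]|noX].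
    by split=> // v Rv fv; apply: nt; exists v.
  exfalso; apply: np; exists w => // t Xt; apply: contrapT => nt.
  exact: (noX t).
left; apply: (@card_le_inj _ _ _ _ f) => [x /fP[]//|x y Sx Sy fxy].
apply: contrapT => /(Rtot _ _ Sx Sy)[Rxy|Ryx].
  by have [_ /(_ _ Rxy)] := fP _ Sy; rewrite fxy.
by have [_ /(_ _ Ryx)] := fP _ Sx; rewrite fxy.
Qed.

(** * Well-orders, initial ordinals and squares of infinite cardinals *)

Section WellOrder.
Context {d : Order.disp_t} {W : orderType d}.
Hypothesis W_wo : well_order (<=%O : rel W).

Lemma wo_min (P : set W) : P !=set0 ->
  exists2 m, P m & forall x, P x -> (m <= x)%O.
Proof.
move=> [x Px]; have [|m [[Pm mmin] _]] := W_wo (A := [pred x | `[< P x >]]).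
  by exists x; exact/asboolP.
exists m => [|y Py]; first exact/asboolP.
by apply: mmin; exact/asboolP.
Qed.

Lemma wo_wf : well_founded (fun x y : W => (x < y)%O).
Proof.
apply: wf_of_minimal => P /wo_min[m Pm mmin]; exists m => // x xm /mmin.
by rewrite leNgt xm.
Qed.

Lemma card_le_or_below (T : Type) (S : set W) (X : set T) :
  S #<= X \/ exists2 p, S p & X #<= below p.
Proof.
apply: card_le_or_initial; first exact: wo_wf.
by move=> x y _ _ /eqP; rewrite neq_lt => /orP.
Qed.

(** Take the least [a] such that [X] embeds in [below a]: comparability gives the reverse embedding,
    and minimality makes [below a] a cardinal. *)
Lemma card_initial (T : Type) (X : set T) : [set: W] #<= X \/
  exists2 a : W, X #= below a & is_cardinal (below a).
Proof.
have [//|[p _ Xp]] := card_le_or_below [set: W] X; first by left.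
have [|a Xa amin] := @wo_min [set a | X #<= below a]; first by exists p.
have aX : below a #<= X.
  have [//|[b ba Xb]] := card_le_or_below (below a) X.
  by have := amin _ Xb; rewrite leNgt ba.
right; exists a; first by rewrite card_eq_le Xa aX.
move=> b ba; split; first by apply: subset_card_le => x /lt_trans; apply.
move=> ab; have := amin b (card_le_trans Xa ab).
by rewrite leNgt ba.
Qed.

(** Goedel's canonical well-order of pairs. Comparing maxima first keeps the predecessors of a pair
    inside the square of a bounded segment. *)
Definition godel_lt (q p : W * W) : Prop :=
  let m r := Order.max r.1 r.2 in
  (m q < m p)%O \/ m q = m p /\ ((q.1 < p.1)%O \/ q.1 = p.1 /\ (q.2 < p.2)%O).

Lemma godel_wf : well_founded godel_lt.
Proof.
pose m (r : W * W) := Order.max r.1 r.2.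
apply: wf_of_minimal => P [r Pr].
have [|a [p Pp pa] amin] := @wo_min [set a | exists2 p, P p & m p = a].
  by exists (m r), r.
have [|b [q [Pq qa] qb] bmin] :=
    @wo_min [set b | exists2 p, P p /\ m p = a & p.1 = b].
  by exists p.1, p.
have [|c [s [Ps [sa sb]] sc] cmin] :=
    @wo_min [set b' | exists2 p, P p /\ m p = a /\ p.1 = b & p.2 = b'].
  by exists q.2, q.
exists s => // x [mx|[xs [x1|[x1 x2]]]] Px.
- by move: mx; rewrite -/(m x) -/(m s) sa ltNge amin//; exists x.
- by move: x1; rewrite sb ltNge bmin//; exists x => //; rewrite -sa.
- by move: x2; rewrite sc ltNge cmin//; exists x => //; rewrite -sa -sb.
Qed.

Lemma godel_total p q : p <> q -> godel_lt p q \/ godel_lt q p.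
Proof.
rewrite /godel_lt; case: (ltgtP (Order.max p.1 p.2) (Order.max q.1 q.2)).
- by move=> H _; left; left.
- by move=> H _; right; left.
move=> mE; case: (ltgtP p.1 q.1).
- by move=> H _; left; right; split=> //; left.
- by move=> H _; right; right; split=> //; left.
move=> e1; case: (ltgtP p.2 q.2).
- by move=> H _; left; right; split=> //; right.
- by move=> H _; right; right; split=> //; right.
by move=> e2; case: p q e1 e2 {mE} => [? ?] [? ?] /= -> ->.
Qed.

(** Otherwise [A] embeds in the Goedel predecessors of one pair, hence in the square of a proper
    segment. That square is finite or absorbed by the induction hypothesis, although [A] is an
    infinite cardinal. *)
Lemma card_square_step (A : set W) :
  (forall x y, A y -> (x < y)%O -> A x) -> infinite_set A -> is_cardinal A ->
  (forall b, A b -> infinite_set (below b) ->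
    below b `*` below b #<= below b) ->
  A `*` A #<= A.
Proof.
move=> Adown Ainf Acard IH.
have [//|[p [Ap1 Ap2] Ap]] : A `*` A #<= A \/
    exists2 p, (A `*` A) p & A #<= [set q | godel_lt q p].
  apply: card_le_or_initial; first exact: godel_wf.
  by move=> x y _ _; exact: godel_total.
exfalso; pose m := Order.max p.1 p.2.
have Am : A m by rewrite /m; case: leP.
(* A greatest element [m] could be removed without loss of size, which would embed [A] in
   [below m]. *)
have [m' Am' mm'] : exists2 m', A m' & (m < m')%O.
  apply: contrapT => nm; have [_] := Acard _ Am; apply.
  apply: card_le_trans (card_le_setD1 m Ainf) _.
  apply: subset_card_le => x [Ax /= /eqP xm].
  rewrite /below /= lt_neqAle xm /= leNgt; apply/negP => mx.
  by apply: nm; exists x.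
have Am'2 : A #<= below m' `*` below m'.
  apply: card_le_trans Ap _; apply: subset_card_le => q Rq.
  have : (Order.max q.1 q.2 <= m)%O by case: Rq => [/ltW|[->]].
  by rewrite ge_max => /andP[? ?]; split; exact: le_lt_trans mm'.
have [m'fin|m'inf] := pselect (finite_set (below m')).
  by apply: Ainf; apply: card_le_finite Am'2 _; exact: finite_setX.
by have [_] := Acard _ Am'; apply; exact: card_le_trans Am'2 (IH _ Am' m'inf).
Qed.

Lemma card_square_below (a : W) : infinite_set (below a) ->
  below a `*` below a #<= below a.
Proof.
elim: (wo_wf a) => {}a _ IH ainf.
have [[b ba ab]|nab] := pselect (exists2 b, (b < a)%O & below a #<= below b).
  have binf : infinite_set (below b).
    by move=> /(card_le_finite ab).
  apply: card_le_trans (card_leX ab ab) _.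
  apply: card_le_trans (IH _ ba binf) _.
  by apply: subset_card_le => x /lt_trans; apply.
apply: card_square_step => // [x y|b ba]; first by move=> /[swap] /lt_trans; apply.
split; first by apply: subset_card_le => x /lt_trans; apply.
by move=> ab; apply: nab; exists b.
Qed.

Lemma card_square (T : Type) (X : set T) :
  is_cardinal [set: W] -> X #<= [set: W] -> infinite_set X -> X `*` X #<= X.
Proof.
move=> Wcard XW Xinf.
have [WX|[a]] := card_initial X.
  apply: card_le_trans (card_leX XW XW) _; apply: card_le_trans WX.
  apply: card_square_step => //; first by move=> /(card_le_finite XW).
  by move=> b _; exact: card_square_below.
rewrite card_eq_le => /andP[Xa aX] _.
apply: card_le_trans (card_leX Xa Xa) _; apply: card_le_trans aX.
by apply: card_square_below => /(card_le_finite Xa).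
Qed.

End WellOrder.

(** * Regularity of the successor cardinal *)

Section SuccessorCardinal.
Context {d d' : Order.disp_t} {L : orderType d} {K : orderType d'}.
Hypothesis L_wo : well_order (<=%O : rel L).
Hypothesis K_wo : well_order (<=%O : rel K).
Hypothesis L_card : is_cardinal [set: L].
Hypothesis L_inf : infinite_set [set: L].
Hypothesis K_succ : is_successor_cardinal L K.

Lemma card_below_succ (a : K) : below a #<= [set: L].
Proof.
have [Kcard _ Kmin] := K_succ.
have [Ka|[m am /Kmin]] := card_initial K_wo (below a).
  by have [] := Kcard a I.
by apply: card_le_trans; move: am; rewrite card_eq_le => /andP[].
Qed.

Lemma succ_gt (a : K) : exists b, (a < b)%O.
Proof.
apply: contrapT => na; have [_ [LK KL] _] := K_succ; apply: KL.
have Kinf : infinite_set [set: K] by move=> /(card_le_finite LK).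
apply: card_le_trans (card_le_setD1 a Kinf) _.
apply: card_le_trans (card_below_succ a); apply: subset_card_le => x [_ /= /eqP xa].
by rewrite /below /= ltNge le_eqVlt eq_sym (negbTE xa) /=; apply/negP => ax;
  apply: na; exists x.
Qed.

Lemma card_bigcup_le (T I : Type) (J : set I) (F : I -> set T) :
  J #<= [set: L] -> (forall i, J i -> F i #<= [set: L]) ->
  \bigcup_(i in J) F i #<= [set: L].
Proof.
move=> JL FL; apply: card_le_trans (card_le_bigcup FL) _.
apply: card_le_trans (card_leX JL (card_lexx _)) _.
exact (card_square L_wo L_card (card_lexx _) L_inf).
Qed.

(** A cofinal [h] would make [K] a union of at most [L] many segments, each no larger than [L]. *)
Lemma succ_bounded (T : Type) (J : set T) (h : T -> K) :
  J #<= [set: L] -> exists a, forall j, J j -> (h j < a)%O.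
Proof.
move=> JL; apply: contrapT => na; have [_ [_ KL] _] := K_succ; apply: KL.
apply: (@card_le_trans _ _ _ (\bigcup_(j in J) [set x | (x <= h j)%O])).
  apply: subset_card_le => x _; apply: contrapT => nx; apply: na; exists x.
  by move=> j Jj; rewrite ltNge; apply/negP => xj; apply: nx; exists j.
apply: card_bigcup_le => // j _; have [b hb] := succ_gt (h j).
apply: card_le_trans (card_below_succ b); apply: subset_card_le => x /=.
by move=> /le_lt_trans; apply.
Qed.

Lemma big_unbounded (H : set K) (x : K) : ~ (H #<= [set: L]) ->
  exists2 y, H y & (x < y)%O.
Proof.
move=> HL; apply: contrapT => ny; apply: HL; have [b xb] := succ_gt x.
apply: card_le_trans (card_below_succ b); apply: subset_card_le => y Hy.
apply: le_lt_trans xb; rewrite leNgt; apply/negP => xy; apply: ny.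
by exists y.
Qed.

Lemma unbounded_card (H : set K) : (forall x, exists2 y, H y & (x <= y)%O) ->
  H #= [set: K].
Proof.
move=> Hcof; rewrite card_eq_le card_leT /=.
have [//|[p _ Hp]] := card_le_or_below K_wo [set: K] H.
have [a aP] := succ_bounded id (card_le_trans Hp (card_below_succ p)).
by have [y /aP ya] := Hcof a; rewrite leNgt ya.
Qed.

(** * The successor is not weakly compact *)

(** The lexicographic order on subsets of [L]. The first difference [c] is a parameter because the
    chain argument is an induction on it. *)
Definition lex_at (c : L) (A B : set L) : Prop :=
  [/\ forall e, (e < c)%O -> A e <-> B e, ~ A c & B c].

(* Sierpinski: if every x in H first splits from its successor in H at the
   same c, then the elements of H first split from each other before c. *)
Lemma lex_chain_step (r : K -> set L) (S : set L) :
  (forall c, S c -> forall H : set K,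
    (forall x y, H x -> H y -> (x < y)%O ->
      exists2 e, (e < c)%O & lex_at e (r x) (r y)) -> H #<= [set: L]) ->
  forall H : set K,
    (forall x y, H x -> H y -> (x < y)%O ->
      exists2 e, S e & lex_at e (r x) (r y)) -> H #<= [set: L].
Proof.
move=> IH H Hlex; apply: contrapT => HL.
have /choice[s sP] (x : K) : exists y, [/\ H y, (x < y)%O &
    forall z, H z -> (x < z)%O -> (y <= z)%O].
  have [|y [Hy xy] ymin] := @wo_min _ _ K_wo [set y | H y /\ (x < y)%O].
    by have [y] := big_unbounded x HL; exists y.
  by exists y; split=> // z Hz xz; exact: ymin.
have /choice[c cP] (x : K) : exists e, H x -> S e /\ lex_at e (r x) (r (s x)).
  have [Hx|nx] := pselect (H x).
    by have [? xs _] := sP x; have [//|e] := Hlex x (s x) Hx _ xs; exists e.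
  have [l _] : [set: L] !=set0 by exact: infinite_setN0.
  by exists l.
apply: HL; apply: (@card_le_trans _ _ _ (\bigcup_(e in S) [set x | H x /\ c x = e])).
  by apply: subset_card_le => x Hx; exists (c x) => //; have [] := cP x Hx.
apply: card_bigcup_le => [|e Se]; first exact: card_leT.
apply: (IH _ Se) => x y [Hx xe] [Hy ye] xy.
have [Hs xs smin] := sP x.
have [_] := cP _ Hx; rewrite xe => -[xsE xe0 se].
have [_] := cP _ Hy; rewrite ye => -[_ ye0 _].
have := smin _ Hy xy; rewrite le_eqVlt => /orP[/eqP sy|sy].
  by rewrite sy in se.
have [c' _ [c'E nsc' yc']] := Hlex _ _ Hs Hy sy.
(* [r (s x)] contains [e] and [r y] does not, while their first difference lies in [r y]; so it
   comes before [e], where [r x] agrees with [r (s x)]. *)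
have c'e : (c' < e)%O.
  case: (ltgtP c' e) => [//|ec'|c'E'].
    by case: ye0; apply/c'E.
  by rewrite c'E' in nsc'.
exists c' => //; split=> //; last by move/(xsE _ c'e).
by move=> z zc'; rewrite xsE ?c'E//; exact: lt_trans c'e.
Qed.

(** Well-founded induction on a strict bound for the first differences, with one last step over all
    of [L]. *)
Lemma lex_chain (r : K -> set L) (H : set K) :
  (forall x y, H x -> H y -> (x < y)%O -> exists e, lex_at e (r x) (r y)) ->
  H #<= [set: L].
Proof.
move=> Hlex; apply: (@lex_chain_step r [set: L]); last first.
  by move=> x y Hx Hy xy; have [e] := Hlex _ _ Hx Hy xy; exists e.
move=> c _; elim: (wo_wf L_wo c) => {}c _ IH.
exact: (@lex_chain_step r (below c)).
Qed.

Lemma succ_not_weakly_compact : ~ weakly_compact K.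
Proof.
have [_ [_ KL] _] := K_succ.
move=> [_ _ Kpart].
(* Otherwise the powerset of [L] embeds below a point of [K], hence into [L], against Cantor. *)
have Kpow : [set: K] #<= [set: set L].
  have [//|[p _ pP]] := card_le_or_below K_wo [set: K] [set: set L].
  by case: (cantor (T := L)); exact: card_le_trans pP (card_below_succ p).
have [r [_ rI]] := card_le_fun set0 Kpow.
have [H [HK [c Hc]]] := Kpart (fun x y => `[< exists e, lex_at e (r x) (r y) >]).
apply: KL; apply: (@card_le_trans _ _ _ H).
  by move: HK; rewrite card_eq_le => /andP[].
case: c Hc => Hc.
  by apply: (@lex_chain r) => x y Hx Hy xy; exact/asboolP/Hc.
(* For the other colour [r] is decreasing on [H], so the complements increase. *)
apply: (@lex_chain (fun x => ~` r x)) => x y Hx Hy xy.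
have [|e /= neq emin] := @wo_min _ _ L_wo [set e | ~ (r x e <-> r y e)].
  apply/not_existsP => rxy; have : x = y; last by move=> E; rewrite E ltxx in xy.
  apply: rI => //; apply/seteqP; split=> e; have /contrapT := rxy e; tauto.
have emin' z : (z < e)%O -> r x z <-> r y z.
  by move=> ze; apply: contrapT => /emin; rewrite leNgt ze.
have nxy : ~ (~ r x e /\ r y e).
  move=> [nx ye]; have /asboolP := Hc _ _ Hx Hy xy; apply.
  by exists e.
exists e; split=> /=; first by move=> z /emin' H'; rewrite /setC /=; tauto.
  by rewrite /setC/=; tauto.
by rewrite /setC/=; tauto.
Qed.

(** * The lower bound *)

Hypothesis L_limit : limit_of_strongly_compacts L.
Hypothesis L_sing : card_lt (cof L) [set: L].

Lemma limit_gt (a : L) : exists b, (a < b)%O.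
Proof. by have [m []] := L_limit a; exists m. Qed.

(** The least segment that receives a cofinal set, or else all of [L], yields a cofinal set of least
    size; hence [cof] is not the default of [xget]. *)
Lemma cofP : cofinal_set (cof L) /\
  forall B : set L, cofinal_set B -> cof L #<= B.
Proof.
rewrite /cof; case: xgetP => [A _ //|noA]; exfalso.
have cofT : cofinal_set [set: L] by move=> x; exists x.
have [[A [a [Acof Aa]]]|nA] := pselect (exists (A : set L) (a : L),
    cofinal_set A /\ A #<= below a).
  have [|b [B Bcof Bb] bmin] := @wo_min _ _ L_wo
      [set b | exists2 A : set L, cofinal_set A & A #<= below b].
    by exists a, A.
  apply: (noA B); split=> // C Ccof.
  have [bC|[p pb Cp]] := card_le_or_below L_wo (below b) C.
    exact: card_le_trans Bb bC.
  have : (b <= p)%O by apply: bmin; exists C.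
  by rewrite leNgt pb.
apply: (noA [set: L]); split=> // C Ccof.
have [//|[p _ Cp]] := card_le_or_below L_wo [set: L] C.
by case: nA; exists C, p.
Qed.

Lemma cof_gt (x : L) : exists2 a, cof L a & (x < a)%O.
Proof.
have [b xb] := limit_gt x; have [+ _] := cofP => /(_ b)[a Aa ba].
by exists a => //; exact: lt_le_trans ba.
Qed.

Lemma cof_infinite : infinite_set (cof L).
Proof.
have [Acof _] := cofP; have [l _] : [set: L] !=set0 by exact: infinite_setN0.
have /choice[s sP] (x : L) : exists y, cof L y /\ (x < y)%O.
  by have [y] := cof_gt x; exists y.
(* The shift [n.+1] skips [l], which need not lie in [cof L]. *)
apply/infiniteP; apply: (@card_le_inj _ _ _ _ (fun n => iter n.+1 s l)).
  by move=> n _; have [] := sP (iter n s l).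
have sinc m n : (m < n)%N -> (iter m s l < iter n s l)%O.
  elim: n => // n IHn; rewrite ltnS leq_eqVlt => /orP[/eqP ->|/IHn mn].
    by have [] := sP (iter n s l).
  by apply: lt_trans mn _; have [] := sP (iter n s l).
move=> m n _ _ E; case: (ltngtP m n) => // mn.
  by have := sinc m.+1 n.+1 mn; rewrite E ltxx.
by have := sinc n.+1 m.+1 mn; rewrite E ltxx.
Qed.

(** Sort the points below [b] into sets [E a] by an injection into [L]. Either some [E a] is cofinal
    in [b], or each has a bound [h a], and the bounds along [cof L] form a cofinal set, small
    because [L] is singular. *)
Lemma small_cofinal (b : K) : exists A p, [/\ A `<=` below b,
  forall x, (x < b)%O -> exists2 a, A a & (x <= a)%O & A #<= below (p : L)].
Proof.
have [l _] : [set: L] !=set0 by exact: infinite_setN0.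
have [e [_ eI]] := card_le_fun l (card_below_succ b).
pose E a := [set x | (x < b)%O /\ (e x < a)%O].
have [[a Ecof]|nE] := pselect (exists a,
    forall x, (x < b)%O -> exists2 y, E a y & (x <= y)%O).
  exists (E a), a; split=> // [x []//|].
  apply: (@card_le_inj _ _ _ _ e) => [x []//|x y [xb _] [yb _]]; exact: eI.
have /choice[h hP] (a : L) : exists y, (y < b)%O /\ forall x, E a x -> (x < y)%O.
  apply: contrapT => ny; apply: nE; exists a => x xb; apply: contrapT => nx.
  apply: ny; exists x; split=> // y Ey; rewrite ltNge; apply/negP => xy.
  by apply: nx; exists y.
have [LA|[p _ Ap]] := card_le_or_below L_wo [set: L] (cof L).
  by have [] := L_sing.
exists (h @` cof L), p; split.
- by move=> _ [a _ <-]; have [] := hP a.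
- move=> x xb; have [a Aa xa] := cof_gt (e x).
  by exists (h a); [exists a|have [_ /(_ x (conj xb xa))/ltW] := hP a].
- exact: card_le_trans (card_image_le _ _) Ap.
Qed.

(** Adjoin to [A] its limits below [b]. A point of [D] is determined by whether it lies in [A] and
    by the least element of [A] not below it, so the size at most doubles. *)
Lemma club_closure (b : K) (A : set K) : A `<=` below b ->
  (forall x, (x < b)%O -> exists2 a, A a & (x <= a)%O) ->
  exists D, [/\ closed_below b D, supremums D = supremums (below b) &
    D #<= [set: bool] `*` A].
Proof.
move=> Ab Acof.
pose lim g := A `&` below g !=set0 /\ supremums (A `&` below g) g.
pose D := [set g | (g < b)%O /\ (A g \/ lim g)].
have AD : A `<=` D by move=> x Ax; split; [exact: Ab|left].
have ubE (X Y : set K) : ubound X = ubound Y -> supremums X = supremums Y.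
  by rewrite /supremums => ->.
exists D; split.
- split=> [x []//|g gb [x [Dx xg]] Dsup]; split=> //; right; split.
    have [_ [Ax|[[y [Ay yx]] _]]] := Dx; first by exists x.
    by exists y; split=> //; exact: lt_trans yx xg.
  rewrite (ubE _ (D `&` below g))//; apply/seteqP; split=> u uU y.
    move=> [[yb [Ay|[_ [_ ymin]]]] yg]; first exact: uU.
    by apply: ymin => z [Az zy]; apply: uU; split=> //; exact: lt_trans zy yg.
  by move=> [Ay yg]; apply: uU; split=> //; exact: AD.
- apply: ubE; apply/seteqP; split=> u uU y.
    by move=> /Acof[a /AD Da ya]; exact: le_trans ya (uU _ Da).
  by move=> [yb _]; exact: uU.
have /choice[h hP] (g : K) : exists a, D g ->
    [/\ A a, (g <= a)%O & forall z, A z -> (g <= z)%O -> (a <= z)%O].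
  have [[gb _]|nD] := pselect (D g); last by exists g.
  have [|a [Aa ga] amin] := @wo_min _ _ K_wo [set a | A a /\ (g <= a)%O].
    by have [a Aa ga] := Acof _ gb; exists a.
  by exists a => _; split=> // z Az gz; exact: amin.
have hA g : D g -> A g -> h g = g.
  move=> Dg Ag; have [_ gh hmin] := hP _ Dg.
  by apply/le_anti; rewrite gh hmin.
(* Equal values leave no point of [A] from [g] up to [g'], so [g] would bound the set whose supremum
   is [g']. *)
have hlim g g' : (g < g')%O -> D g -> D g' -> ~ A g' -> h g <> h g'.
  move=> gg' Dg Dg' nAg' hE; have [_ [//|[_ [_ g'min]]]] := Dg'.
  have [_ _ hmin] := hP _ Dg; have [_ g'h _] := hP _ Dg'.
  have /g'min : ubound (A `&` below g') g.
    move=> z [Az zg']; rewrite leNgt; apply/negP => gz.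
    by have := hmin _ Az (ltW gz); rewrite hE leNgt (lt_le_trans zg' g'h).
  by rewrite leNgt gg'.
apply: (@card_le_inj _ _ _ _ (fun g => (`[< A g >], h g))).
  by move=> g /hP[].
move=> g g' Dg Dg' [AgE hE].
have AE : A g -> A g' by move=> Ag; apply/asboolP; rewrite -AgE; exact/asboolP.
have EA : A g' -> A g by move=> Ag'; apply/asboolP; rewrite AgE; exact/asboolP.
have [Ag|nAg] := pselect (A g); first by rewrite -(hA g)// hE hA//; exact: AE.
case: (ltgtP g g') => // gg'.
  by case: (hlim _ _ gg' Dg Dg' (contra_not EA nAg)).
by case: (hlim _ _ gg' Dg' Dg nAg).
Qed.

Lemma cof_le_chi (Y : set K) : chi_property Y -> cof L #<= Y.
Proof.
move=> Ychi; apply: contrapT => AY.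
have /choice[C CP] (b : K) : exists D : set K, closed_below b D /\
    supremums D = supremums (below b) /\
    exists p : L, D #<= [set: bool] `*` below p.
  have [A [p [Ab Acof Ap]]] := small_cofinal b.
  have [D [Dcl Dsup DA]] := club_closure Ab Acof.
  exists D; split=> //; split=> //; exists p.
  by apply: card_le_trans DA _; exact: card_leX.
have [|Delta [B [DeltaK BY DC]]] := Ychi C.
  by move=> b; have [? []] := CP b.
have /choice[p pP] (b : K) : exists p : L, C b #<= [set: bool] `*` below p.
  by have [_ []] := CP b.
have [_ [LK _] _] := K_succ.
have [k _] : [set: K] !=set0.
  by apply: infinite_setN0 => /(card_le_finite LK).
have LDelta : [set: L] #<= Delta.
  by apply: card_le_trans LK _; move: DeltaK; rewrite card_eq_le => /andP[].
have [g [gD gI]] := card_le_fun k LDelta.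
have [a aP] := succ_bounded g (card_lexx [set: L]).
have BaY : B a #<= Y by have := BY a; rewrite card_eq_le => /andP[].
(* Unbounded [p b] would form a cofinal subset of [L] no larger than [Y]. *)
have [x xP] : exists x, forall b, B a b -> (p b < x)%O.
  apply: contrapT => nx; apply: AY; have [_ Amin] := cofP.
  apply: card_le_trans BaY; apply: card_le_trans (card_image_le p _).
  apply: Amin => x; apply: contrapT => nxx; apply: nx; exists x => b Bb.
  rewrite ltNge; apply/negP => xp; apply: nxx.
  by exists (p b) => //; exists b.
have [//|[q _ Yq]] := card_le_or_below L_wo (cof L) Y.
(* [below t] is at least as large as [B a], and twice its size bounds each club used, so the
   covering embeds [L] in a set no larger than [below t]. *)
pose t := Order.max x q.
have below_t y : (y <= t)%O -> below y #<= below t.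
  by move=> yt; apply: subset_card_le => z; move/lt_le_trans; apply.
have xt : below x #<= below t by apply: below_t; rewrite le_max lexx.
have qt : below q #<= below t by apply: below_t; rewrite le_max lexx orbT.
have Lt : [set: L] #<= below t `*` ([set: bool] `*` below t).
  apply: (@card_le_trans _ _ _ (\bigcup_(b in B a) C b)).
    apply: card_le_trans (subset_card_le (@DC a)).
    by apply: (@card_le_inj _ _ _ _ g) => [l _|//]; split; [exact: gD|exact: aP].
  apply: card_le_trans (@card_le_bigcup _ _ _ _ _ ([set: bool] `*` below x) _) _.
    move=> b Bb; apply: card_le_trans (pP b) _; apply: card_leX => //.
    by apply: subset_card_le => z /lt_trans; apply; exact: xP.
  apply: card_leX (card_le_trans BaY (card_le_trans Yq qt)) _.
  exact: card_leX.
have tinf : infinite_set (below t).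
  move=> tfin; apply: L_inf; apply: card_le_finite Lt _.
  by do 2?apply: finite_setX.
have boolt : [set: bool] #<= below t.
  by move: tinf => /infiniteP; apply: card_le_trans; exact: countableP.
have sq := card_square_below L_wo tinf.
have [_] := L_card (a := t) I; apply.
apply: card_le_trans Lt _; apply: card_le_trans (sq); apply: card_leX => //.
apply: card_le_trans sq; exact: card_leX.
Qed.

(** * The upper bound *)

(* The function f below represents the supremum of the image of K in the
   ultrapower by U; pushing U forward along f makes it weakly normal. *)
Lemma weakly_normal_filter (T : Type) (M : set T) :
  strongly_compact M -> M #<= [set: L] ->
  exists V : set_system K, [/\ ProperFilter V, card_complete M V,
    forall a, V [set x | (a < x)%O] &
    forall g : K -> K, V [set x | (g x < x)%O] ->
      exists a, V [set x | (g x <= a)%O]].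
Proof.
move=> [Mctbl Mcompact] ML.
pose F : set_system K := [set X | exists a, [set x | (a < x)%O] `<=` X].
have [_ [LK _] _] := K_succ.
have [k0 _] : [set: K] !=set0.
  by apply: infinite_setN0 => /(card_le_finite LK).
have Ffilter : ProperFilter F.
  split; first by move=> [a a0]; have [b /a0] := succ_gt a.
  split; first by exists k0.
  - move=> X Y [a aX] [b bY]; exists (Order.max a b) => x /=.
    by rewrite gt_max => /andP[? ?]; split; [exact: aX|exact: bY].
  - by move=> X Y XY [a aX]; exists a; exact: subset_trans XY.
have Fcomplete : card_complete M F.
  move=> G [GM _] GF.
  have /choice[h hP] (X : set K) : exists a, G X -> [set x | (a < x)%O] `<=` X.
    have [/GF[a aX]|nG] := pselect (G X); first by exists a.
    by exists k0.
  have [a aP] := succ_bounded h (card_le_trans GM ML).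
  by exists a => x /= ax X GX; apply: hP => //=; exact: lt_trans (aP _ GX) ax.
have [U [Uultra Ucomplete FU]] := Mcompact K F Ffilter Fcomplete.
pose Phi (f : K -> K) := forall a, U [set x | (a < f x)%O].
have [f Phif fmin] : exists2 f, Phi f &
    forall g, Phi g -> ~ U [set x | (g x < f x)%O].
  (* A sequence descending modulo [U] from [id] would, by countable completeness, descend forever at
     a single point. *)
  apply: contrapT => nomin.
  have /choice[s sP] (f : K -> K) : exists g, Phi f ->
      Phi g /\ U [set x | (g x < f x)%O].
    have [Phif|nf] := pselect (Phi f); last by exists f.
    apply: contrapT => ng; apply: nomin; exists f => // g Phig Ug.
    by apply: ng; exists g.
  have Phis n : Phi (iter n s id).
    elim: n => [a|n /sP[]//]; apply: FU; by exists a.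
  have : U (\bigcap_n [set x | (iter n.+1 s id x < iter n s id x)%O]).
    by apply: countably_complete Mctbl Ucomplete _ => n; have [] := sP _ (Phis n).
  move=> /filter_ex[x xdec].
  have [|_ [n _ <-] mmin] := @wo_min _ _ K_wo (range (fun n => iter n s id x)).
    by exists x, 0%N.
  have := mmin (iter n.+1 s id x); rewrite leNgt xdec//= => /(_ _)/negP; apply=> //.
  by exists n.+1.
exists [set X | U (f @^-1` X)]; split.
- split; first by rewrite /= preimage_set0; exact: filter_not_empty.
  split; first by rewrite /= preimage_setT; exact: filterT.
  - by move=> X Y /= UX UY; rewrite preimage_setI; exact: filterI.
  - by move=> X Y XY /=; apply: filterS => x /=; exact: XY.
- move=> G GM GU /=.
  have -> : f @^-1` (\bigcap_(A in G) A) = \bigcap_(A in G) (f @^-1` A) by [].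
  exact: complete_bigcap Ucomplete GM GU.
- exact: Phif.
(* If no bound exists, [g \o f] exceeds every constant modulo the ultrafilter [U], yet stays below
   [f]. *)
- move=> g gf; apply: contrapT => ng; apply: (fmin (g \o f)) => // a.
  have [//|nU] := in_ultra_setVsetC [set x | (a < g (f x))%O] Uultra.
  case: ng; exists a => /=; apply: filterS nU => x /= nax.
  by rewrite leNgt; apply/negP.
Qed.

Lemma chi_le_cof (X : set K) : X #= cof L -> chi_property X.
Proof.
move=> XA C Cseq.
have /choice[m /all_and3[ml mcard msc]] (l : L) := L_limit l.
have /choice[V /all_and4[Vfilter Vcomplete Vlarge Vnormal]] (l : L) :=
  weakly_normal_filter (msc l) (card_leT (below (m l))).
have Vnext l c : exists a, V l [set b | exists2 x, C b x & (c < x <= a)%O].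
  (* The margin [c'] is needed: if [b] is the successor of [c], then [C b] has no point above
     [c]. *)
  have [c' cc'] := succ_gt c.
  have Cgt b : (c' < b)%O -> exists2 x, C b x & (c < x)%O.
    move=> c'b; apply: contrapT => nx; have [_ Csup] := Cseq b.
    have [|s sub smin] := @wo_min _ _ K_wo (ubound (below b)).
      by exists b => x /ltW.
    have : supremums (C b) s by rewrite Csup; split.
    move=> [_ smin']; have /smin' : ubound (C b) c.
      by move=> x Cx; rewrite leNgt; apply/negP => cx; apply: nx; exists x.
    by rewrite leNgt (lt_le_trans cc' (sub _ c'b)).
  have /choice[g gP] (b : K) : exists x, (c' < b)%O -> C b x /\ (c < x)%O.
    have [/Cgt[x Cx cx]|nb] := pselect (c' < b)%O; first by exists x.
    by exists b.
  (* [g] is regressive beyond [c'], so weak normality bounds it on a set in [V l]. *)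
  have [|a Va] := Vnormal l g.
    apply: filterS (Vlarge l c') => b /= c'b; have [Cg _] := gP _ c'b.
    by have [[Cb _] _] := Cseq b; exact: Cb.
  exists a; apply: filterS2 (Vlarge l c') Va => b /= /gP[Cg cg] ga.
  by exists (g b) => //; rewrite cg.
have /choice[next nextP] (c : K) : exists c', (c < c')%O /\
    forall l, V l [set b | exists2 x, C b x & (c < x < c')%O].
  have /choice[h hP] l := Vnext l c.
  have [a aP] := succ_bounded h (card_lexx [set: L]).
  have [c' cc'] := succ_gt c.
  exists (Order.max a c'); rewrite lt_max cc' orbT; split=> // l.
  apply: filterS (hP l) => b [x Cx /andP[cx xh]]; exists x => //.
  by rewrite cx lt_max (le_lt_trans xh (aP l I)).
pose Delta := [set c | forall l, V l [set b | C b c]].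
have Delta_cof c : exists2 c', Delta c' & (c <= c')%O.
  pose s n := iter n next c.
  have [u uP] : exists u, forall n, (s n < u)%O.
    have [|u uP] := @succ_bounded _ [set: nat] s; first exact/infiniteP.
    by exists u => n; exact: uP.
  (* [w] is the supremum of the iterates. For [V l]-almost all [b] it is a limit of [C b] below [b],
     hence a member of [C b]. *)
  have [|w wub wmin] := @wo_min _ _ K_wo (ubound (range s)).
    by exists u => _ [n _ <-]; exact/ltW.
  have sw n : (s n <= w)%O by apply: wub; exists n.
  have sltw n : (s n < w)%O.
    by apply: lt_le_trans (sw n.+1); have [] := nextP (s n).
  exists w; last exact: (sw 0%N).
  move=> l; have Vs : V l (\bigcap_n
      [set b | exists2 x, C b x & (s n < x < s n.+1)%O]).
    have [Mctbl _] := msc l; apply: countably_complete Mctbl (Vcomplete l) _ => n.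
    by have [_] := nextP (s n).
  apply: filterS2 Vs (Vlarge l w) => b /= sb wb; have [[_ Ccl] _] := Cseq b.
  have sx n : exists2 x, (C b `&` below w) x & (s n < x)%O.
    have [x Cx /andP[sx xs]] := sb n I.
    by exists x => //; split=> //; have := lt_trans xs (sltw n.+1).
  apply: Ccl => //; first by have [x Cx _] := sx 0%N; exists x.
  split; first by move=> x [_ /ltW].
  move=> v vub; apply: wmin => _ [n _ <-]; have [x Cx sxn] := sx n.
  exact: le_trans (ltW sxn) (vub _ Cx).
have [l0 _] : [set: L] !=set0 by exact: infinite_setN0.
have Bex (a : K) : exists B : set K, B #<= cof L /\
    Delta `&` below a `<=` \bigcup_(b in B) C b.
  have [e [_ eI]] := card_le_fun l0 (card_below_succ a).
  have /choice[h hP] (l : L) : exists b, forall c, Delta c -> (c < a)%O ->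
      (e c < l)%O -> C b c.
    pose P := [set c | [/\ Delta c, (c < a)%O & (e c < l)%O]].
    (* The injection [e] maps [P] into [below l], which is smaller than the cardinal
       [below (m l)]. *)
    have Pm : card_lt P (below (m l)).
      have Pl : P #<= below l.
        apply: (@card_le_inj _ _ _ _ e) => [c []//|x y [_ xa _] [_ ya _]].
        exact: eI.
      have [lm nlm] := mcard l l (ml l); split; first exact: card_le_trans Pl lm.
      by move=> mP; apply: nlm; exact: card_le_trans mP Pl.
    have : V l (\bigcap_(c in P) [set b | C b c]).
      by apply: complete_bigcap (Vcomplete l) Pm _ => c [Dc _ _]; exact: Dc.
    move=> /(@filter_ex _ _ (Vfilter l))[b bP].
    by exists b => c Dc ca cl; exact: bP.
  exists (h @` cof L); split; first exact: card_image_le.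
  move=> c [Dc ca]; have [l Al el] := cof_gt (e c).
  by exists (h l); [exists l|exact: hP].
have /choice[B BP] := Bex.
(* Adding [X] raises the size of [B a] to exactly that of the infinite set [X]. *)
exists Delta, (fun a => B a `|` X); split.
- exact: unbounded_card.
- move=> a; move: XA; rewrite card_eq_le => /andP[XA AX].
  rewrite card_eq_le (subset_card_le (@subsetUr _ _ _)) andbT.
  have Xinf : infinite_set X by move=> /(card_le_finite AX) /cof_infinite.
  have -> : B a `|` X = \bigcup_(b in [set: bool]) (if b then B a else X).
    apply/seteqP; split=> x; first by case=> ?; [exists true|exists false].
    by case=> -[] _ ?; [left|right].
  apply: (@card_le_trans _ _ _ ([set: bool] `*` X)).
    apply: card_le_bigcup => b _; case: b => //.
    by have [BA _] := BP a; exact: card_le_trans BA AX.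
  apply: (@card_le_trans _ _ _ (X `*` X)).
    apply: card_leX => //; apply: card_le_trans (countableP _) _.
    exact/infiniteP.
  by apply: (card_square L_wo L_card _ Xinf); exact: card_le_trans XA (card_leT _).
- move=> a c /(proj2 (BP a))[b Bb Cc]; exists b => //; by left.
Qed.

End SuccessorCardinal.

(** * The value of [chi] at the successor *)

Theorem theorem2p10 (d d' : Order.disp_t) (L : orderType d) (K : orderType d')
    (L_wo : well_order (<=%O : rel L)) (K_wo : well_order (<=%O : rel K))
    (L_singular : singular_cardinal L)
    (L_limit : limit_of_strongly_compacts L)
    (K_succ : is_successor_cardinal L K) :
  chi K #= cof L.
Proof.
have [L_card L_inf L_sing] := L_singular.
have lower := @cof_le_chi _ _ _ _ L_wo K_wo L_card L_inf K_succ L_limit L_sing.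
have upper := @chi_le_cof _ _ _ _ L_wo K_wo L_card L_inf K_succ L_limit.
(* [chi K] is a subset of [K], so [cof L] is first copied into [K]. *)
have [X XA] : exists X : set K, X #= cof L.
  have [_ [LK _] _] := K_succ.
  have [k _] : [set: K] !=set0.
    by apply: infinite_setN0 => /(card_le_finite LK).
  have [f [_ fI]] := card_le_fun k LK.
  by exists (f @` cof L); apply: inj_card_eq => x y _ _; exact: fI.
have [AX XA'] : cof L #<= X /\ X #<= cof L.
  by move: XA; rewrite card_eq_le => /andP[].
rewrite /chi; case: (pselect (weakly_compact K)) => [wc|nwc].
  by case: (succ_not_weakly_compact L_wo K_wo L_card L_inf K_succ).
case: xgetP => [Z _ [Zchi Zmin]|noZ].
  rewrite card_eq_le (lower _ Zchi) andbT.
  exact: card_le_trans (Zmin _ (upper _ XA)) XA'.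
case: (noZ X); split; first exact: upper.
by move=> Y /lower; exact: card_le_trans.
Qed.
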